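(* Let $0<|q|<1$ and $u\in\mathbb{C}$. Then \[ \sum_{i,j\geq0}\frac{(-1)^{i}u^{i+j}q^{i^2+2ij+2j^2-i-j}}{(q;q)_{i}(q^{2};q^{2})_{j}}=(u;q^{2})_{\infty}, \qquad \sum_{i,j\geq0}\frac{(-1)^{i} u^{i+2j}q^{i^2+2ij+2j^2-i-j}}{(q;q)_{i}(q^{2};q^{2})_{j}}=(u;q)_{\infty}. \]
   Context: For $b\in\mathbb{C}$ and $|p|<1$: $(b;p)_0=1$, $(b;p)_n=\prod_{k=0}^{n-1}(1-bp^k)$, $(b;p)_\infty=\prod_{k\ge0}(1-bp^k)$. *)

(* Defs.v *)
From Stdlib Require Import Reals.
From Coquelicot Require Import Coquelicot.
Open Scope C_scope.

Fixpoint qpoch (b p : C) (n : nat) : C :=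
  match n with
  | O => 1
  | S k => qpoch b p k * (1 - b * p ^ k)
  end.

(* [iota] picks the unique limit when it exists (see [iota_filterlim_locally]),
   which is the case whenever [Cmod p < 1]; the value is unspecified
   otherwise. *)
Definition qpoch_inf (b p : C) : C :=
  iota (T := C_CompleteNormedModule)
    (fun l => filterlim (qpoch b p) eventually (locally l)).

(* Absolute convergence makes the sum independent of the order of summation, so
   that it is also the value of both iterated sums.  Note that [sum_n f n] is
   the sum of [f k] for [0 <= k <= n]. *)
Definition is_double_series (a : nat -> nat -> C) (s : C) : Prop :=
  (exists M : R, forall m n : nat,
     (sum_n (fun i => sum_n (fun j => Cmod (a i j)) n) m <= M)%R) /\
  filterlim (fun mn : nat * nat =>
               sum_n (fun i => sum_n (fun j => a i j) (snd mn)) (fst mn))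
    (filter_prod eventually eventually) (locally s).

(* Main.v *)
(* Collect the summands with the same power of [u].  In the first sum the
   coefficient of [u^n] is a convolution of the coefficients of [1 / (z; q)_oo]
   and [(zq; q^2)_oo], whose product is [1 / (z; q^2)_oo]; in the second it is
   one of [(-z; q)_oo] and [1 / (z^2; q^2)_oo], whose product is [1 / (z; q)_oo].
   What remains is Euler's expansion of [(u; p)_oo] for [p = q^2] and [p = q].
   Regrouping is legitimate because the summands are [O(4^-(i+j))], the factor
   [q^(i(i-1)/2)] beating every geometric growth. *)
Require Import Defs.
From Stdlib Require Import Reals Lra Lia.
From Coquelicot Require Import Coquelicot.
Open Scope C_scope.

(** * Euler's coefficients and elementary limits *)

(** The binomial exponent [n(n-1)/2], given by recursion so that no division of naturals arises. *)
Fixpoint tri (n : nat) : nat :=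
  match n with
  | O => O
  | S k => (tri k + k)%nat
  end.

(** By Euler, the coefficient of [z^n] in [(-z; p)_oo]. *)
Definition euler_coef (p : C) (n : nat) : C := p ^ tri n / qpoch p p n.

Lemma tri_double (n : nat) : (2 * tri n + n = n * n)%nat.
Proof. induction n as [|n IH]; simpl tri; lia. Qed.

Lemma filterlim_seq_C (f : nat -> C) (l : C) :
  filterlim f eventually (locally l) <->
  (forall eps : R, (0 < eps)%R ->
     exists N : nat, forall n, (N <= n)%nat -> (Cmod (f n - l) < eps)%R).
Proof.
  rewrite (filterlim_locally_ball_norm (U := C_NormedModule)).
  split.
  - intros H eps Heps. exact (H (mkposreal eps Heps)).
  - intros H eps. exact (H eps (cond_pos eps)).
Qed.

Lemma pow_lt_eps (r K eps : R) :
  (0 <= r < 1)%R -> (0 <= K)%R -> (0 < eps)%R ->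
  exists N : nat, forall n, (N <= n)%nat -> (K * r ^ n < eps)%R.
Proof.
  intros Hr HK Heps.
  destruct (pow_lt_1_zero r) with (y := (eps / (K + 1))%R) as [N HN].
  - rewrite Rabs_pos_eq; lra.
  - apply Rdiv_lt_0_compat; lra.
  - exists N. intros n Hn.
    specialize (HN n Hn).
    assert (Hp : (0 <= r ^ n)%R) by (apply pow_le; lra).
    rewrite Rabs_pos_eq in HN by exact Hp.
    apply (Rmult_lt_compat_l (K + 1)) in HN; [|lra].
    replace ((K + 1) * (eps / (K + 1)))%R with eps in HN by (field; lra).
    lra.
Qed.

Lemma bounded_of_eventually_decreasing (t : nat -> R) (N : nat) :
  (forall n, (N <= n)%nat -> (t (S n) <= t n)%R) ->
  exists K : R, (0 <= K)%R /\ forall n, (t n <= K)%R.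
Proof.
  revert t. induction N as [|N IH]; intros t Ht.
  - exists (Rmax 0 (t O)). split; [apply Rmax_l|].
    induction n as [|n IHn]; [apply Rmax_r|].
    eapply Rle_trans; [apply Ht; lia | exact IHn].
  - destruct (IH (fun n => t (S n))) as [K [HK0 HK]].
    { intros n Hn. apply Ht. lia. }
    exists (Rmax K (t O)). split.
    + eapply Rle_trans; [exact HK0 | apply Rmax_l].
    + intros [|n]; [apply Rmax_r|].
      eapply Rle_trans; [apply HK | apply Rmax_l].
Qed.

(** * Nonvanishing denominators and growth of Euler's coefficients *)

Lemma Cpow_Cmod_le_1 (p : C) (n : nat) : (Cmod p < 1)%R -> (Cmod (p ^ n) <= 1)%R.
Proof.
  intros Hp. rewrite Cmod_pow, <- (pow1 n).
  apply pow_incr. split; [apply Cmod_ge_0 | lra].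
Qed.

Lemma Cmod_one_minus_pow (p : C) (n : nat) :
  (Cmod p < 1)%R -> (1 - Cmod p <= Cmod (1 - p * p ^ n))%R.
Proof.
  intros Hp.
  assert (H1 : (Cmod (p * p ^ n) <= Cmod p)%R).
  { rewrite Cmod_mult. pose proof (Cpow_Cmod_le_1 p n Hp). pose proof (Cmod_ge_0 p). nra. }
  pose proof (Cmod_triangle (1 - p * p ^ n) (p * p ^ n)) as H2.
  replace (1 - p * p ^ n + p * p ^ n) with (RtoC 1) in H2 by ring.
  rewrite Cmod_1 in H2. lra.
Qed.

Lemma one_minus_pow_neq_0 (p : C) (n : nat) : (Cmod p < 1)%R -> 1 - p * p ^ n <> 0.
Proof.
  intros Hp. apply Cmod_gt_0. pose proof (Cmod_one_minus_pow p n Hp). lra.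
Qed.

Lemma qpoch_neq_0 (p : C) (n : nat) : (Cmod p < 1)%R -> qpoch p p n <> 0.
Proof.
  intros Hp. induction n as [|n IH]; simpl.
  - apply C1_nz.
  - apply Cmult_neq_0; [exact IH | apply one_minus_pow_neq_0, Hp].
Qed.

Lemma euler_coef_0 (p : C) : euler_coef p 0 = 1.
Proof. unfold euler_coef. simpl. field. Qed.

Lemma euler_coef_S (p : C) (n : nat) :
  (Cmod p < 1)%R -> euler_coef p (S n) = euler_coef p n * p ^ n / (1 - p * p ^ n).
Proof.
  intros Hp. unfold euler_coef. simpl tri. simpl qpoch. rewrite Cpow_add_r.
  field. split; [apply qpoch_neq_0, Hp | apply one_minus_pow_neq_0, Hp].
Qed.

(** The ratio of consecutive terms is [x |p|^n / |1 - p^(n+1)|], at most 1 as soon as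
    [x |p|^n < 1 - |p|]. As [x] is arbitrary, the coefficients decay faster than any geometric
    sequence. *)
Lemma euler_coef_bound (p : C) (x : R) :
  (Cmod p < 1)%R -> (0 <= x)%R ->
  exists K : R, (0 <= K)%R /\ forall n, (Cmod (euler_coef p n) * x ^ n <= K)%R.
Proof.
  intros Hp Hx.
  destruct (pow_lt_eps (Cmod p) x (1 - Cmod p)) as [N HN];
    [split; [apply Cmod_ge_0 | exact Hp] | exact Hx | lra |].
  apply bounded_of_eventually_decreasing with N. intros n Hn.
  specialize (HN n Hn).
  rewrite euler_coef_S by exact Hp.
  rewrite Cmod_div by (apply one_minus_pow_neq_0, Hp).
  rewrite Cmod_mult, Cmod_pow.
  pose proof (Cmod_one_minus_pow p n Hp) as Hd.
  set (d := Cmod (1 - p * p ^ n)) in *.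
  assert (He : (0 <= Cmod (euler_coef p n) * x ^ n)%R)
    by (apply Rmult_le_pos; [apply Cmod_ge_0 | apply pow_le, Hx]).
  replace (Cmod (euler_coef p n) * Cmod p ^ n / d * x ^ S n)%R
    with (Cmod (euler_coef p n) * x ^ n * (x * Cmod p ^ n / d))%R
    by (simpl; field; lra).
  rewrite <- (Rmult_1_r (Cmod (euler_coef p n) * x ^ n)) at 2.
  apply Rmult_le_compat_l; [exact He|].
  apply Rle_div_l; lra.
Qed.

(** * Euler's expansion of the infinite product *)

Lemma Cmod_sum_n_le (a : nat -> C) (b : nat -> R) (n : nat) :
  (forall k, (k <= n)%nat -> (Cmod (a k) <= b k)%R) ->
  (Cmod (sum_n a n) <= sum_n b n)%R.
Proof.
  induction n as [|n IH]; intros H.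
  - rewrite !sum_O. apply H. lia.
  - rewrite !sum_Sn.
    eapply Rle_trans; [apply Cmod_triangle|].
    apply Rplus_le_compat; [apply IH; intros; apply H | apply H]; lia.
Qed.

Lemma sum_n_half_pow (n : nat) : (sum_n (fun k => (/ 2) ^ k)%R n <= 2)%R.
Proof.
  enough (H : sum_n (fun k => (/ 2) ^ k)%R n = (2 - (/ 2) ^ n)%R)
    by (rewrite H; pose proof (pow_le (/ 2) n); lra).
  induction n as [|n IH].
  - rewrite sum_O. simpl. lra.
  - rewrite sum_Sn, IH. unfold plus; simpl. lra.
Qed.

Lemma ex_series_half_pow (a : nat -> C) (K : R) :
  (forall n, (Cmod (a n) <= K * (/ 2) ^ n)%R) -> ex_series (V := C_NormedModule) a.
Proof.
  intros H.
  apply (ex_series_le (V := C_CompleteNormedModule)) with (b := fun n => (K * (/ 2) ^ n)%R).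
  - exact H.
  - apply (ex_series_scal_l K (fun n => (/ 2) ^ n)%R), ex_series_geom.
    rewrite Rabs_pos_eq; lra.
Qed.

(* The coefficient recursion says that [E(x) = sum c_n x^n] satisfies
   [E(x) = (1 + x) E(p x)]. *)
Lemma euler_series_step (p x l : C) :
  (Cmod p < 1)%R ->
  is_series (V := C_NormedModule) (fun n => euler_coef p n * (x * p) ^ n) l ->
  is_series (V := C_NormedModule) (fun n => euler_coef p n * x ^ n) ((1 + x) * l).
Proof.
  intros Hp Hl.
  set (s := fun n => match n with
                     | O => RtoC 0
                     | S k => x * (euler_coef p k * (x * p) ^ k)
                     end).
  assert (Hs : is_series (V := C_NormedModule) s (x * l)).
  { apply (is_series_decr_1 (V := C_NormedModule)).
    match goal with |- is_series _ ?r => change r with (x * l + - 0) end.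
    replace (x * l + - 0) with (x * l) by ring.
    apply (is_series_scal (V := C_NormedModule) x _ _ Hl). }
  pose proof (is_series_plus (V := C_NormedModule) _ _ _ _ Hl Hs) as H.
  match type of H with is_series _ ?r => change r with (l + x * l) in H end.
  replace ((1 + x) * l) with (l + x * l) by ring.
  eapply is_series_ext; [|exact H].
  intros [|n]; unfold s.
  - change (euler_coef p 0 * 1 + 0 = euler_coef p 0 * 1). ring.
  - change (euler_coef p (S n) * (x * p) ^ S n + x * (euler_coef p n * (x * p) ^ n)
            = euler_coef p (S n) * x ^ S n).
    rewrite euler_coef_S by exact Hp. rewrite !Cpow_mult_l, !Cpow_S.
    field. apply one_minus_pow_neq_0, Hp.
Qed.

(** Iterating [E(x) = (1 + x) E(p x)] leaves a remainder [E(x p^m)]; this shows that it tends to 1.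
    The bound [K] is independent of [m]. *)
Lemma euler_series_near_1 (p x : C) :
  (Cmod p < 1)%R ->
  exists K : R, (0 <= K)%R /\
    forall m : nat, exists l : C,
      is_series (V := C_NormedModule) (fun n => euler_coef p n * (x * p ^ m) ^ n) l /\
      (Cmod (l - 1) <= K * Cmod p ^ m)%R.
Proof.
  intros Hp.
  (* Doubling [|x|] leaves a spare factor [2^-n], which makes the series summable uniformly in
     [m]. *)
  destruct (euler_coef_bound p (2 * Cmod x) Hp) as [K [HK0 HK]].
  { pose proof (Cmod_ge_0 x). lra. }
  assert (Hpm : forall m, (0 <= Cmod p ^ m <= 1)%R).
  { intros m. rewrite <- Cmod_pow. split; [apply Cmod_ge_0 | apply Cpow_Cmod_le_1, Hp]. }
  assert (Hterm : forall m n, (Cmod (euler_coef p n * (x * p ^ m) ^ n)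
                     <= K * (/ 2) ^ n * (Cmod p ^ m) ^ n)%R).
  { intros m n. rewrite Cmod_mult, Cmod_pow, Cmod_mult, Cmod_pow, Rpow_mult_distr.
    rewrite <- Rmult_assoc. apply Rmult_le_compat_r; [apply pow_le, Hpm|].
    replace (Cmod (euler_coef p n) * Cmod x ^ n)%R
      with (Cmod (euler_coef p n) * (2 * Cmod x) ^ n * (/ 2) ^ n)%R.
    - apply Rmult_le_compat_r; [apply pow_le; lra | apply HK].
    - rewrite Rmult_assoc, <- Rpow_mult_distr. do 2 f_equal. field. }
  exists (2 * K)%R. split; [lra|]. intros m.
  destruct (ex_series_half_pow (fun n => euler_coef p n * (x * p ^ m) ^ n) K) as [l Hl].
  { intros n. eapply Rle_trans; [apply Hterm|].
    rewrite <- (Rmult_1_r (K * (/ 2) ^ n)) at 2.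
    apply Rmult_le_compat_l.
    - apply Rmult_le_pos; [exact HK0 | apply pow_le; lra].
    - rewrite <- (pow1 n). apply pow_incr, Hpm. }
  exists l. split; [exact Hl|].
  pose proof (proj1 (filterlim_seq_C _ _) Hl) as Hlim.
  apply le_epsilon. intros eps Heps.
  destruct (Hlim eps Heps) as [N HN].
  (* The index [S N] guarantees a tail after the constant term 1; each term of that tail carries at
     least one factor [|p|^m]. *)
  specialize (HN (S N) ltac:(lia)).
  set (S1 := sum_n (fun n => euler_coef p n * (x * p ^ m) ^ n) (S N)).
  change (Cmod (S1 - l) < eps)%R in HN.
  assert (H1 : (Cmod (S1 - 1) <= 2 * K * Cmod p ^ m)%R).
  { assert (Hsplit : S1 - 1 = sum_n (fun n => euler_coef p (S n) * (x * p ^ m) ^ S n) N).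
    { unfold S1. clear. induction N as [|N IH].
      - rewrite sum_Sn, !sum_O, euler_coef_0. unfold plus; simpl. ring.
      - rewrite sum_Sn. rewrite (sum_Sn (fun n => euler_coef p (S n) * (x * p ^ m) ^ S n)), <- IH.
        unfold plus; simpl. ring. }
    rewrite Hsplit.
    eapply Rle_trans; [apply Cmod_sum_n_le with (b := fun n => (K * Cmod p ^ m * (/ 2) ^ n)%R)|].
    - intros k _. eapply Rle_trans; [apply Hterm|].
      pose proof (Hpm m) as Hr. set (r := (Cmod p ^ m)%R) in *.
      assert (Hrk : (0 <= r ^ k <= 1)%R).
      { split; [apply pow_le; lra | rewrite <- (pow1 k); apply pow_incr; lra]. }
      assert (H2 : (0 <= (/ 2) ^ k)%R) by (apply pow_le; lra).
      simpl.
      replace (K * (/ 2 * (/ 2) ^ k) * (r * r ^ k))%R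
        with (K * r * (/ 2) ^ k * (/ 2 * r ^ k))%R by ring.
      rewrite <- (Rmult_1_r (K * r * (/ 2) ^ k)) at 2.
      apply Rmult_le_compat_l; [|lra].
      apply Rmult_le_pos; [apply Rmult_le_pos; lra | exact H2].
    - rewrite (sum_n_mult_l (K := R_Ring)).
      replace (2 * K * Cmod p ^ m)%R with (K * Cmod p ^ m * 2)%R by ring.
      apply Rmult_le_compat_l; [|apply sum_n_half_pow].
      apply Rmult_le_pos; [exact HK0 | apply Hpm]. }
  replace (l - 1) with (- (S1 - l) + (S1 - 1)) by ring.
  eapply Rle_trans; [apply Cmod_triangle|]. rewrite Cmod_opp. lra.
Qed.

(** Writing [l = E(-u)], iteration gives [l = (u; p)_m E(-u p^m)] with last factor tending to 1.
    Hence the finite products converge to [l], so convergence of the infinite product is obtained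
    along the way. *)
Lemma euler_series (p u : C) :
  (Cmod p < 1)%R ->
  is_series (V := C_NormedModule) (fun n => euler_coef p n * (- u) ^ n) (qpoch_inf u p).
Proof.
  intros Hp.
  destruct (euler_series_near_1 p (- u) Hp) as [K [HK0 HK]].
  destruct (HK O) as [l [Hl _]].
  assert (Hl0 : is_series (V := C_NormedModule) (fun n => euler_coef p n * (- u) ^ n) l).
  { eapply is_series_ext; [|exact Hl]. intros n. simpl. f_equal. f_equal. ring. }
  assert (Hprod : forall (m : nat) (r : C),
    is_series (V := C_NormedModule) (fun n => euler_coef p n * (- u * p ^ m) ^ n) r ->
    l = qpoch u p m * r).
  { induction m as [|m IH]; intros r Hr.
    - rewrite (filterlim_locally_unique (V := C_NormedModule) _ _ _ Hl Hr). simpl. ring.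
    - simpl. rewrite (IH ((1 - u * p ^ m) * r)); [ring|].
      replace (1 - u * p ^ m) with (1 + - u * p ^ m) by ring.
      apply euler_series_step; [exact Hp|].
      eapply is_series_ext; [|exact Hr]. intros n. simpl. f_equal. f_equal. ring. }
  replace (qpoch_inf u p) with l; [exact Hl0|].
  symmetry. unfold qpoch_inf.
  apply (iota_filterlim_locally (V := C_CompleteNormedModule)).
  apply filterlim_seq_C. intros eps Heps.
  pose proof (Cmod_ge_0 l) as HL.
  (* With [d = |r - 1|], the bound [d c < 1] yields both [d < 1/2] and [d (2 eps + 2 |l|) < eps].
     The first gives [|r| > 1/2], hence [|P| <= 2 |l|]; the second then gives [|P| d < eps]. *)
  set (c := (2 + 2 * Cmod l / eps)%R).
  assert (Hc : (2 <= c)%R).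
  { unfold c. pose proof (Rdiv_le_0_compat (2 * Cmod l) eps). lra. }
  assert (Hce : (c * eps = 2 * eps + 2 * Cmod l)%R) by (unfold c; field; lra).
  clearbody c.
  destruct (pow_lt_eps (Cmod p) (K * c) 1) as [N HN];
    [split; [apply Cmod_ge_0 | exact Hp] | apply Rmult_le_pos; lra | lra |].
  exists N. intros m Hm. specialize (HN m Hm).
  destruct (HK m) as [r [Hr Hr1]].
  pose proof (f_equal Cmod (Hprod m r Hr)) as HlP. rewrite Cmod_mult in HlP.
  rewrite (Hprod m r Hr).
  set (P := qpoch u p m) in *.
  replace (P - P * r) with (- (P * (r - 1))) by ring.
  rewrite Cmod_opp, Cmod_mult.
  pose proof (Cmod_triangle r (- (r - 1))) as H1.
  replace (r + - (r - 1)) with (RtoC 1) in H1 by ring.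
  rewrite Cmod_1, Cmod_opp in H1.
  pose proof (Cmod_ge_0 P) as HP.
  pose proof (Cmod_ge_0 (r - 1)) as Hd.
  set (d := Cmod (r - 1)) in *.
  assert (Hdc : (d * c < 1)%R).
  { apply Rle_lt_trans with (K * Cmod p ^ m * c)%R; [|lra].
    apply Rmult_le_compat_r; lra. }
  assert (Hd2 : (d < / 2)%R) by nra.
  assert (HPL : (Cmod P <= 2 * Cmod l)%R) by nra.
  assert (Hde : (d * (2 * eps + 2 * Cmod l) < eps)%R) by (rewrite <- Hce; nra).
  assert (HPd : (Cmod P * d <= 2 * Cmod l * d)%R) by (apply Rmult_le_compat_r; lra).
  assert (0 <= d * eps)%R by (apply Rmult_le_pos; lra).
  lra.
Qed.

(** * Formal power series as coefficient sequences *)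

(* [ring] does not see through [AbelianMonoid.sort C_AbelianMonoid], the type
   of an equation whose left-hand side is a [sum_n]. *)
Ltac eq_in_C := match goal with |- ?a = ?b => change (@eq C a b) end.

Ltac Cring := eq_in_C; ring.

(* [shift] is multiplication by the variable of a generating series. *)
Definition shift (a : nat -> C) (n : nat) : C :=
  match n with
  | O => 0
  | S k => a k
  end.

(** Multiplication of a generating series by [1 + c z]. *)
Definition mul_1cX (c : C) (a : nat -> C) (n : nat) : C := a n + c * shift a n.

Definition conv (a b : nat -> C) (n : nat) : C := sum_n (fun i => a i * b (n - i)%nat) n.

Lemma sum_n_SC (f : nat -> C) (n : nat) : sum_n f (S n) = sum_n f n + f (S n).
Proof. rewrite sum_Sn. reflexivity. Qed.

Lemma sum_n_head (f : nat -> C) (n : nat) :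
  sum_n f (S n) = f O + sum_n (fun k => f (S k)) n.
Proof.
  induction n as [|n IH].
  - rewrite sum_n_SC, !sum_O. reflexivity.
  - rewrite sum_n_SC, IH, (sum_n_SC (fun k => f (S k))). Cring.
Qed.

Lemma sum_n_lin (f g : nat -> C) (c : C) (n : nat) :
  sum_n (fun k => f k + c * g k) n = sum_n f n + c * sum_n g n.
Proof.
  induction n as [|n IH].
  - rewrite !sum_O. reflexivity.
  - rewrite !sum_n_SC, IH. Cring.
Qed.

Lemma sum_n_scal_C (f : nat -> C) (c : C) (n : nat) :
  sum_n (fun k => c * f k) n = c * sum_n f n.
Proof. apply (sum_n_mult_l (K := C_Ring)). Qed.

Lemma conv_ext (a a' b b' : nat -> C) (n : nat) :
  (forall k, a k = a' k) -> (forall k, b k = b' k) -> conv a b n = conv a' b' n.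
Proof.
  intros Ha Hb. apply sum_n_ext. intros k. rewrite Ha, Hb. reflexivity.
Qed.

Lemma mul_1cX_ext (c : C) (a a' : nat -> C) (n : nat) :
  (forall k, a k = a' k) -> mul_1cX c a n = mul_1cX c a' n.
Proof.
  intros H. unfold mul_1cX, shift. destruct n; rewrite !H; reflexivity.
Qed.

(** The substitution [z -> x z] respects products of generating series. *)
Lemma conv_scale (x : C) (a b : nat -> C) (n : nat) :
  conv (fun k => x ^ k * a k) (fun k => x ^ k * b k) n = x ^ n * conv a b n.
Proof.
  unfold conv. rewrite <- sum_n_scal_C. apply sum_n_ext_loc. intros k Hk.
  replace (x ^ n) with (x ^ k * x ^ (n - k)) by (rewrite <- Cpow_add_r; f_equal; lia).
  Cring.
Qed.

(** With its mirror image [conv_mul_1cX_r], this lets a factor [1 + c z] pass from one factor of a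
    product to the other. *)
Lemma conv_mul_1cX_l (c : C) (a b : nat -> C) (n : nat) :
  conv (mul_1cX c a) b n = mul_1cX c (conv a b) n.
Proof.
  unfold conv at 1, mul_1cX.
  transitivity (sum_n (fun i => a i * b (n - i)%nat
                                + c * (shift a i * b (n - i)%nat)) n).
  { apply sum_n_ext. intros i. Cring. }
  rewrite sum_n_lin. do 2 f_equal.
  destruct n as [|n].
  - rewrite sum_O. simpl. ring.
  - rewrite sum_n_head. simpl shift. unfold conv. simpl Nat.sub. Cring.
Qed.

Lemma conv_mul_1cX_r (c : C) (a b : nat -> C) (n : nat) :
  conv a (mul_1cX c b) n = mul_1cX c (conv a b) n.
Proof.
  unfold conv at 1, mul_1cX.
  transitivity (sum_n (fun i => a i * b (n - i)%nat
                                + c * (a i * shift b (n - i)%nat)) n).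
  { apply sum_n_ext. intros i. Cring. }
  rewrite sum_n_lin. do 2 f_equal.
  destruct n as [|n].
  - rewrite sum_O. simpl. ring.
  - rewrite sum_n_SC, Nat.sub_diag. change (shift b 0) with (RtoC 0).
    change (shift _ (S n)) with (conv a b n). unfold conv.
    rewrite (sum_n_ext_loc _ (fun i => a i * b (n - i)%nat)); [Cring|].
    intros i Hi. cbv beta. rewrite Nat.sub_succ_l by exact Hi. reflexivity.
Qed.

(** Coefficientwise [1 / (p z; p)_oo = (1 - z) / (z; p)_oo]. *)
Lemma inv_qpoch_scale (p : C) (n : nat) :
  (Cmod p < 1)%R ->
  p ^ n * / qpoch p p n = mul_1cX (- (1)) (fun k => / qpoch p p k) n.
Proof.
  intros Hp. unfold mul_1cX. destruct n as [|n]; simpl.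
  - field.
  - field. split; [apply qpoch_neq_0, Hp | apply one_minus_pow_neq_0, Hp].
Qed.

(** The functional equation [A(p z) = (1 - z) A(z)] reads [(1 - p^(n+1)) a_(n+1) = a_n], so it and
    the constant term determine [A]. *)
Lemma eq_inv_qpoch (p : C) (a : nat -> C) :
  (Cmod p < 1)%R -> a O = 1 ->
  (forall n, p ^ n * a n = mul_1cX (- (1)) a n) ->
  forall n, a n = / qpoch p p n.
Proof.
  intros Hp H0 H n. induction n as [|n IH].
  - rewrite H0. simpl. field.
  - specialize (H (S n)). unfold mul_1cX in H. simpl shift in H. rewrite IH in H.
    pose proof (one_minus_pow_neq_0 p n Hp) as H1.
    pose proof (qpoch_neq_0 p n Hp) as H2.
    assert (E : a (S n) * (1 - p * p ^ n) = / qpoch p p n).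
    { rewrite Cpow_S in H.
      replace (a (S n) * (1 - p * p ^ n)) with (a (S n) - p * p ^ n * a (S n)) by ring.
      rewrite H. ring. }
    simpl. replace (a (S n)) with (a (S n) * (1 - p * p ^ n) / (1 - p * p ^ n))
      by (field; exact H1).
    rewrite E. field. split; assumption.
Qed.

(** Coefficientwise [E(x z) = (1 + x z) E(p x z)]. *)
Lemma euler_coef_scale (p x : C) (n : nat) :
  (Cmod p < 1)%R ->
  x ^ n * euler_coef p n = mul_1cX x (fun k => p ^ k * (x ^ k * euler_coef p k)) n.
Proof.
  intros Hp. unfold mul_1cX. destruct n as [|n].
  - simpl. ring.
  - simpl shift. rewrite euler_coef_S, !Cpow_S by exact Hp.
    field. apply one_minus_pow_neq_0, Hp.
Qed.

(** * The two product identities behind the convolutions *)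

Lemma Cmod_sqr_lt_1 (q : C) : (Cmod q < 1)%R -> (Cmod (q ^ 2) < 1)%R.
Proof.
  intros Hq. rewrite Cmod_pow. pose proof (Cmod_ge_0 q). simpl. nra.
Qed.

(* Coefficientwise [(zq; q^2)_oo / (z; q)_oo = 1 / (z; q^2)_oo]: both sides are
   multiplied by [1 - z] under [z -> q^2 z]. *)
Lemma conv_inv_qpoch_euler (q : C) (n : nat) :
  (Cmod q < 1)%R ->
  conv (fun i => / qpoch q q i) (fun j => (- q) ^ j * euler_coef (q ^ 2) j) n
  = / qpoch (q ^ 2) (q ^ 2) n.
Proof.
  intros Hq. pose proof (Cmod_sqr_lt_1 q Hq) as Hq2. revert n.
  set (a := fun i => / qpoch q q i).
  set (b := fun j => (- q) ^ j * euler_coef (q ^ 2) j).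
  apply (eq_inv_qpoch (q ^ 2) (conv a b) Hq2).
  - unfold conv. rewrite sum_O. unfold a, b. simpl. rewrite euler_coef_0. field.
  - intros n. rewrite <- conv_scale.
    (* For [A(z) = 1 / (z; q)_oo]: [A(q^2 z) = (1 - q z) A(q z)]. *)
    assert (Ha : forall k, (q ^ 2) ^ k * a k = mul_1cX (- q) (fun i => q ^ i * a i) k).
    { intros k. rewrite <- Cpow_mult_r. replace (2 * k)%nat with (k + k)%nat by lia.
      rewrite Cpow_add_r, <- Cmult_assoc. unfold a at 1. rewrite (inv_qpoch_scale q k Hq).
      unfold mul_1cX, a. destruct k as [|k]; simpl; ring. }
    rewrite (conv_ext _ _ _ _ n Ha (fun k => eq_refl)).
    (* The factor [1 - q z] moves to [B(q^2 z)] and turns it into [B(z)]; what remains is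
       [A(q z) = (1 - z) A(z)]. *)
    rewrite conv_mul_1cX_l, <- conv_mul_1cX_r, <- conv_mul_1cX_l.
    apply conv_ext; intros k.
    + apply (inv_qpoch_scale q k Hq).
    + symmetry. apply (euler_coef_scale (q ^ 2) (- q) k Hq2).
Qed.

(* The coefficients of [b(z^2)]. *)
Definition even_ext (b : nat -> C) (m : nat) : C :=
  if Nat.even m then b (Nat.div2 m) else 0.

(* Coefficientwise [(-z; q)_oo / (z^2; q^2)_oo = 1 / (z; q)_oo]: both sides are
   multiplied by [1 - z] under [z -> q z]. *)
Lemma conv_euler_inv_qpoch_even (q : C) (n : nat) :
  (Cmod q < 1)%R ->
  conv (euler_coef q) (even_ext (fun j => / qpoch (q ^ 2) (q ^ 2) j)) n
  = / qpoch q q n.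
Proof.
  intros Hq. pose proof (Cmod_sqr_lt_1 q Hq) as Hq2. revert n.
  set (b := even_ext (fun j => / qpoch (q ^ 2) (q ^ 2) j)).
  apply (eq_inv_qpoch q (conv (euler_coef q) b) Hq).
  - unfold conv. rewrite sum_O, euler_coef_0. unfold b, even_ext. simpl. field.
  - intros n. rewrite <- conv_scale.
    (* For [B(z) = 1 / (z^2; q^2)_oo]: [B(q z) = (1 - z^2) B(z)], factored so that [1 + z] can be
       split off. *)
    assert (Hb : forall k, q ^ k * b k = mul_1cX 1 (mul_1cX (- (1)) b) k).
    { intros k. unfold mul_1cX. destruct k as [|[|k]]; simpl shift.
      - unfold b, even_ext. simpl. ring.
      - unfold b, even_ext. simpl. ring.
      - transitivity (b (S (S k)) - b k); [|ring].
        unfold b, even_ext. simpl Nat.even. simpl Nat.div2.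
        destruct (Nat.even k) eqn:Ek; [|ring].
        apply Nat.even_spec in Ek. destruct Ek as [j ->].
        rewrite Nat.div2_double.
        change (qpoch (q ^ 2) (q ^ 2) (S j))
          with (qpoch (q ^ 2) (q ^ 2) j * (1 - q ^ 2 * (q ^ 2) ^ j)).
        replace (q ^ S (S (2 * j))) with (q ^ 2 * (q ^ 2) ^ j)
          by (rewrite <- Cpow_mult_r, <- Cpow_add_r; reflexivity).
        pose proof (one_minus_pow_neq_0 (q ^ 2) j Hq2).
        pose proof (qpoch_neq_0 (q ^ 2) j Hq2).
        set (P := qpoch (q ^ 2) (q ^ 2) j) in *.
        set (t := q ^ 2 * (q ^ 2) ^ j) in *.
        field. split; assumption. }
    rewrite (conv_ext _ _ _ _ n (fun k => eq_refl) Hb).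
    (* The factor [1 + z] moves to the other series, where [(1 + z) E(q z) = E(z)]; the factor
       [1 - z] is the one required. *)
    rewrite conv_mul_1cX_r, <- conv_mul_1cX_l, <- conv_mul_1cX_r.
    apply conv_ext; intros k; [|reflexivity].
    pose proof (euler_coef_scale q 1 k Hq) as H. rewrite Cpow_1_l, Cmult_1_l in H.
    rewrite H. apply mul_1cX_ext. intros i. rewrite Cpow_1_l. ring.
Qed.

(** * Finite double sums by antidiagonals *)

Lemma sum_n_single (f : nat -> C) (k n : nat) :
  (k <= n)%nat -> sum_n (fun j => if j =? k then f j else RtoC 0) n = f k.
Proof.
  assert (Hz : forall m, (m < k)%nat -> sum_n (fun j => if j =? k then f j else RtoC 0) m = RtoC 0).
  { induction m as [|m IH]; intros Hm.
    - rewrite sum_O. destruct (Nat.eqb_spec 0 k); [lia | reflexivity].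
    - rewrite sum_n_SC, IH by lia. destruct (Nat.eqb_spec (S m) k); [lia | Cring]. }
  induction n as [|n IH]; intros Hk.
  - rewrite sum_O. destruct (Nat.eqb_spec 0 k); [subst; reflexivity | lia].
  - rewrite sum_n_SC. destruct (Nat.eqb_spec (S n) k) as [<-|Hne].
    + rewrite Hz by lia. Cring.
    + rewrite IH by lia. Cring.
Qed.

Lemma sum_n_truncate (f : nat -> C) (k n : nat) :
  (k <= n)%nat -> sum_n (fun j => if j <=? k then f j else RtoC 0) n = sum_n f k.
Proof.
  induction n as [|n IH]; intros Hk.
  - replace k with O by lia. rewrite !sum_O. reflexivity.
  - destruct (Nat.eq_dec k (S n)) as [->|Hne].
    + apply sum_n_ext_loc. intros j Hj.
      destruct (Nat.leb_spec j (S n)); [reflexivity | lia].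
    + rewrite sum_n_SC, IH by lia.
      destruct (Nat.leb_spec (S n) k); [lia | Cring].
Qed.

Lemma sum_n_antidiagonal (A : nat -> nat -> C) (k m n : nat) :
  (k <= m)%nat -> (k <= n)%nat ->
  sum_n (fun i => sum_n (fun j => if (i + j =? k)%nat then A i j else RtoC 0) n) m
  = sum_n (fun i => A i (k - i)%nat) k.
Proof.
  intros Hm Hn. rewrite <- (sum_n_truncate _ k m Hm).
  apply sum_n_ext. intros i.
  destruct (Nat.leb_spec i k) as [Hi|Hi].
  - rewrite <- (sum_n_single (A i) (k - i) n) by lia.
    apply sum_n_ext. intros j.
    destruct (Nat.eqb_spec (i + j) k), (Nat.eqb_spec j (k - i)); lia || reflexivity.
  - transitivity (sum_n (fun j => 0 * A i j) n).
    + apply sum_n_ext. intros j. destruct (Nat.eqb_spec (i + j) k); [lia | Cring].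
    + rewrite sum_n_scal_C. Cring.
Qed.

(** The part of a rectangular partial sum below the antidiagonal [N] does not depend on the
    rectangle once this contains the triangle. *)
Lemma sum_n_triangle (A : nat -> nat -> C) (N m n : nat) :
  (N <= m)%nat -> (N <= n)%nat ->
  sum_n (fun i => sum_n (fun j => if (i + j <=? N)%nat then A i j else RtoC 0) n) m
  = sum_n (fun k => sum_n (fun i => A i (k - i)%nat) k) N.
Proof.
  induction N as [|N IH]; intros Hm Hn.
  - rewrite sum_O, <- (sum_n_antidiagonal A 0 m n Hm Hn).
    apply sum_n_ext. intros i. apply sum_n_ext. intros j.
    destruct (Nat.leb_spec (i + j) 0), (Nat.eqb_spec (i + j) 0); lia || reflexivity.
  - rewrite sum_n_SC, <- IH, <- (sum_n_antidiagonal A (S N) m n Hm Hn) by lia.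
    rewrite <- (sum_n_plus (G := C_AbelianMonoid)). apply sum_n_ext. intros i.
    rewrite <- (sum_n_plus (G := C_AbelianMonoid)). apply sum_n_ext. intros j.
    destruct (Nat.leb_spec (i + j) (S N)), (Nat.leb_spec (i + j) N),
      (Nat.eqb_spec (i + j) (S N)); try lia; unfold plus; simpl; ring.
Qed.

(** * From antidiagonal sums to double series *)

Lemma double_sum_half_pow_le (a : nat -> nat -> R) (K : R) (m n : nat) :
  (0 <= K)%R ->
  (forall i j, (a i j <= K * (/ 2) ^ (i + j))%R) ->
  (sum_n (fun i => sum_n (fun j => a i j) n) m <= 4 * K)%R.
Proof.
  intros HK Ha.
  apply Rle_trans with (sum_n (fun i => 2 * K * (/ 2) ^ i)%R m).
  - apply sum_n_m_le. intros i.
    apply Rle_trans with (sum_n (fun j => K * (/ 2) ^ i * (/ 2) ^ j)%R n).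
    + apply sum_n_m_le. intros j. rewrite Rmult_assoc, <- pow_add. apply Ha.
    + rewrite (sum_n_mult_l (K := R_Ring)).
      replace (2 * K * (/ 2) ^ i)%R with (K * (/ 2) ^ i * 2)%R by ring.
      apply Rmult_le_compat_l; [|apply sum_n_half_pow].
      apply Rmult_le_pos; [exact HK | apply pow_le; lra].
  - rewrite (sum_n_mult_l (K := R_Ring)).
    replace (4 * K)%R with (2 * K * 2)%R by ring.
    apply Rmult_le_compat_l; [lra | apply sum_n_half_pow].
Qed.

Lemma filterlim_prod_seq_C (f : nat * nat -> C) (l : C) :
  filterlim f (filter_prod eventually eventually) (locally l) <->
  (forall eps : R, (0 < eps)%R ->
     exists N : nat, forall m n, (N <= m)%nat -> (N <= n)%nat ->
       (Cmod (f (m, n) - l) < eps)%R).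
Proof.
  rewrite (filterlim_locally_ball_norm (U := C_NormedModule)).
  split.
  - intros H eps Heps. destruct (H (mkposreal eps Heps)) as [P Q [N1 H1] [N2 H2] H3].
    exists (max N1 N2). intros m n Hm Hn.
    apply (H3 m n); [apply H1 | apply H2]; lia.
  - intros H eps. destruct (H eps (cond_pos eps)) as [N HN].
    exists (fun m => (N <= m)%nat) (fun n => (N <= n)%nat);
      [exists N; auto | exists N; auto | exact HN].
Qed.

(** A rectangular sum is a triangle plus a remainder with [i + j > N]. Splitting [4^-k = 2^-k 2^-k],
    one factor makes the remainder small, of order [2^-N], and the other keeps it summable. *)
Lemma is_double_series_antidiagonals (A : nat -> nat -> C) (K : R) (s : C) :
  (0 <= K)%R ->
  (forall i j, (Cmod (A i j) <= K * (/ 4) ^ (i + j))%R) ->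
  is_series (V := C_NormedModule) (fun k => sum_n (fun i => A i (k - i)%nat) k) s ->
  is_double_series A s.
Proof.
  intros HK HA Hs.
  assert (H42 : forall n, ((/ 4) ^ n = (/ 2) ^ n * (/ 2) ^ n)%R).
  { intros n. rewrite <- Rpow_mult_distr. f_equal. lra. }
  assert (H2 : forall n, (0 <= (/ 2) ^ n <= 1)%R).
  { intros n. split; [apply pow_le; lra | rewrite <- (pow1 n); apply pow_incr; lra]. }
  split.
  - exists (4 * K)%R. intros m n. apply double_sum_half_pow_le; [exact HK|].
    intros i j. eapply Rle_trans; [apply HA|].
    rewrite H42. pose proof (H2 (i + j)%nat). apply Rmult_le_compat_l; [exact HK | nra].
  - apply filterlim_prod_seq_C. intros eps Heps.
    destruct (proj1 (filterlim_seq_C _ _) Hs (eps / 2)%R) as [N1 HN1]; [lra|].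
    destruct (pow_lt_eps (/ 2) (4 * K) (eps / 2)) as [N2 HN2]; [lra | lra | lra |].
    set (N := max N1 N2).
    specialize (HN1 N ltac:(lia)). specialize (HN2 N ltac:(lia)).
    exists N. intros m n Hm Hn. simpl fst. simpl snd.
    set (T := sum_n (fun k => sum_n (fun i => A i (k - i)%nat) k) N).
    change (Cmod (T - s) < eps / 2)%R in HN1.
    set (U := sum_n (fun i => sum_n (fun j => if (i + j <=? N)%nat then RtoC 0 else A i j) n) m).
    assert (HU : sum_n (fun i => sum_n (fun j => A i j) n) m = T + U).
    { unfold T, U. rewrite <- (sum_n_triangle A N m n Hm Hn).
      rewrite <- (sum_n_plus (G := C_AbelianMonoid)). apply sum_n_ext. intros i.
      rewrite <- (sum_n_plus (G := C_AbelianMonoid)). apply sum_n_ext. intros j.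
      destruct (i + j <=? N)%nat; unfold plus; simpl; ring. }
    rewrite HU.
    assert (HUle : (Cmod U <= 4 * (K * (/ 2) ^ N))%R).
    { eapply Rle_trans.
      - apply Cmod_sum_n_le with
          (b := fun i => sum_n (fun j => Cmod (if (i + j <=? N)%nat then RtoC 0 else A i j)) n).
        intros i _. apply Cmod_sum_n_le. intros j _. apply Rle_refl.
      - apply double_sum_half_pow_le.
        + apply Rmult_le_pos; [exact HK | apply H2].
        + intros i j. destruct (Nat.leb_spec (i + j) N) as [Hij|Hij].
          * rewrite Cmod_0. apply Rmult_le_pos; [apply Rmult_le_pos; [exact HK|]|]; apply H2.
          * eapply Rle_trans; [apply HA|]. rewrite H42, <- Rmult_assoc.
            apply Rmult_le_compat_r; [apply H2|].
            apply Rmult_le_compat_l; [exact HK|].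
            replace (i + j)%nat with (N + (i + j - N))%nat by lia.
            rewrite pow_add. pose proof (H2 N). pose proof (H2 (i + j - N)%nat). nra. }
    replace (T + U - s) with (T - s + U) by ring.
    eapply Rle_lt_trans; [apply Cmod_triangle|]. lra.
Qed.

(** * Padding the second index with zeros at odd places *)

(** Stated over any commutative monoid, as it serves both the real sums of moduli and the complex
    sums. *)
Lemma sum_n_even {G : AbelianMonoid} (f : nat -> G) (n : nat) :
  sum_n (fun m => if Nat.even m then f (Nat.div2 m) else zero) (2 * n) = sum_n f n.
Proof.
  induction n as [|n IH].
  - rewrite !sum_O. reflexivity.
  - replace (2 * S n)%nat with (S (S (2 * n))) by lia.
    rewrite !sum_Sn, IH.
    replace (S (S (2 * n))) with (2 * S n)%nat by lia.
    rewrite Nat.div2_double, Nat.even_mul.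
    replace (Nat.even (S (2 * n))) with false
      by (rewrite Nat.even_succ, Nat.odd_mul; reflexivity).
    rewrite plus_zero_r. reflexivity.
Qed.

(** In the second sum the power [u^(i+2j)] is not constant on antidiagonals; after replacing [j] by
    [m = 2j] it is. *)
Lemma is_double_series_even (A : nat -> nat -> C) (s : C) :
  is_double_series (fun i => even_ext (A i)) s -> is_double_series A s.
Proof.
  intros [[M HM] Hlim]. split.
  - exists M. intros m n. rewrite <- (HM m (2 * n)%nat). apply Req_le.
    apply sum_n_ext. intros i.
    rewrite <- (sum_n_even (fun j => Cmod (A i j)) n).
    apply sum_n_ext. intros j. unfold even_ext.
    destruct (Nat.even j); [reflexivity | symmetry; apply Cmod_0].
  - apply filterlim_prod_seq_C. intros eps Heps.
    destruct (proj1 (filterlim_prod_seq_C _ _) Hlim eps Heps) as [N HN].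
    exists N. intros m n Hm Hn.
    specialize (HN m (2 * n)%nat Hm ltac:(lia)).
    simpl fst in *. simpl snd in *.
    replace (sum_n (fun i => sum_n (fun j => A i j) n) m)
      with (sum_n (fun i => sum_n (fun j => even_ext (A i) j) (2 * n)) m); [exact HN|].
    apply sum_n_ext. intros i. apply (sum_n_even (A i) n).
Qed.

(** * Summand estimates and the final comparison of coefficients *)

Lemma euler_coef_geometric_bound (p x : C) (r : R) :
  (Cmod p < 1)%R -> (0 < r)%R ->
  exists K : R, (0 <= K)%R /\ forall n, (Cmod (euler_coef p n * x ^ n) <= K * r ^ n)%R.
Proof.
  intros Hp Hr.
  destruct (euler_coef_bound p (Cmod x / r) Hp) as [K [HK0 HK]].
  { apply Rdiv_le_0_compat; [apply Cmod_ge_0 | exact Hr]. }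
  exists K. split; [exact HK0|]. intros n.
  rewrite Cmod_mult, Cmod_pow.
  replace (Cmod x ^ n)%R with ((Cmod x / r) ^ n * r ^ n)%R.
  - rewrite <- Rmult_assoc. apply Rmult_le_compat_r; [apply pow_le; lra | apply HK].
  - rewrite <- Rpow_mult_distr. f_equal. field. lra.
Qed.

(** The exponent is split into what two Euler coefficients absorb and a remaining power of [q], of
    modulus at most 1. *)
Lemma summand_euler_coef (q w : C) (i j : nat) :
  (Cmod q < 1)%R ->
  w * q ^ (i ^ 2 + 2 * i * j + 2 * j ^ 2 - i - j)
    / (qpoch q q i * qpoch (q ^ 2) (q ^ 2) j)
  = w * euler_coef q i * euler_coef (q ^ 2) j * q ^ (tri i + 2 * i * j + j * j).
Proof.
  intros Hq.
  replace (i ^ 2 + 2 * i * j + 2 * j ^ 2 - i - j)%nat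
    with (tri i + 2 * tri j + (tri i + 2 * i * j + j * j))%nat.
  - unfold euler_coef. rewrite <- Cpow_mult_r.
    rewrite (Cpow_add_r q (tri i + 2 * tri j)), (Cpow_add_r q (tri i)).
    field. split; apply qpoch_neq_0; [apply Cmod_sqr_lt_1|]; exact Hq.
  - pose proof (tri_double i). pose proof (tri_double j).
    rewrite !Nat.pow_2_r. lia.
Qed.

(** The rate [r] in [j] is left free: the second sum needs [4^-2] where the first needs [4^-1]. *)
Lemma summand_bound (q x y : C) (r : R) :
  (Cmod q < 1)%R -> (0 < r)%R ->
  exists K : R, (0 <= K)%R /\ forall i j,
    (Cmod (x ^ i * y ^ j * q ^ (i ^ 2 + 2 * i * j + 2 * j ^ 2 - i - j)
           / (qpoch q q i * qpoch (q ^ 2) (q ^ 2) j)) <= K * (/ 4) ^ i * r ^ j)%R.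
Proof.
  intros Hq Hr.
  destruct (euler_coef_geometric_bound q x (/ 4) Hq) as [K1 [HK1 H1]]; [lra|].
  destruct (euler_coef_geometric_bound (q ^ 2) y r (Cmod_sqr_lt_1 q Hq) Hr)
    as [K2 [HK2 H2]].
  exists (K1 * K2)%R. split; [apply Rmult_le_pos; assumption|]. intros i j.
  rewrite summand_euler_coef by exact Hq.
  set (e := (tri i + 2 * i * j + j * j)%nat).
  replace (x ^ i * y ^ j * euler_coef q i * euler_coef (q ^ 2) j * q ^ e)
    with ((euler_coef q i * x ^ i) * (euler_coef (q ^ 2) j * y ^ j) * q ^ e) by ring.
  rewrite Cmod_mult, Cmod_mult.
  replace (K1 * K2 * (/ 4) ^ i * r ^ j)%R
    with ((K1 * (/ 4) ^ i) * (K2 * r ^ j) * 1)%R by ring.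
  repeat apply Rmult_le_compat; try apply Cmod_ge_0;
    [apply Rmult_le_pos; apply Cmod_ge_0 | apply H1 | apply H2
    | apply Cpow_Cmod_le_1, Hq].
Qed.

(* Stdlib / Coquelicot. The truncated subtraction in the exponent is exact,
   since i <= i^2 and j <= 2 j^2. *)
Theorem theorem3p9 (q u : C) (hq0 : (0 < Cmod q)%R) (hq1 : (Cmod q < 1)%R) :
  is_double_series
    (fun i j : nat =>
       (-(1)) ^ i * u ^ (i + j) * q ^ (i ^ 2 + 2 * i * j + 2 * j ^ 2 - i - j)
       / (qpoch q q i * qpoch (q ^ 2) (q ^ 2) j))
    (qpoch_inf u (q ^ 2)) /\
  is_double_series
    (fun i j : nat =>
       (-(1)) ^ i * u ^ (i + 2 * j) * q ^ (i ^ 2 + 2 * i * j + 2 * j ^ 2 - i - j)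
       / (qpoch q q i * qpoch (q ^ 2) (q ^ 2) j))
    (qpoch_inf u q).
Proof.
  pose proof (Cmod_sqr_lt_1 q hq1) as Hq2.
  assert (Hsgn : forall n, (- u) ^ n = (- (1)) ^ n * u ^ n).
  { intros n. rewrite <- Cpow_mult_l. f_equal. ring. }
  assert (Hsq : forall n, (- (1)) ^ n * (- (1)) ^ n = 1).
  { intros n. rewrite <- Cpow_mult_l. replace (- (1) * - (1)) with (RtoC 1) by ring.
    apply Cpow_1_l. }
  split.
  - destruct (summand_bound q (- u) u (/ 4) hq1) as [K [HK0 HK]]; [lra|].
    apply is_double_series_antidiagonals with K; [exact HK0 | |].
    + intros i j. rewrite pow_add, <- Rmult_assoc.
      rewrite Cpow_add_r, Cmult_assoc, <- Hsgn. apply HK.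
    + eapply is_series_ext; [|apply (euler_series _ u Hq2)]. intros n. eq_in_C.
      (* The factor [1 / (q^2; q^2)_n] of Euler's term is expanded as a convolution, to be matched
         with the antidiagonal term by term. *)
      transitivity ((- u) ^ n * (q ^ 2) ^ tri n *
        conv (fun i => / qpoch q q i) (fun j => (- q) ^ j * euler_coef (q ^ 2) j) n).
      { rewrite conv_inv_qpoch_euler by exact hq1.
        unfold euler_coef. field. apply qpoch_neq_0, Hq2. }
      unfold conv. rewrite <- sum_n_scal_C. apply sum_n_ext_loc. intros i Hi. eq_in_C.
      set (j := (n - i)%nat). replace n with (i + j)%nat by lia.
      rewrite summand_euler_coef by exact hq1.
      unfold euler_coef. rewrite Hsgn, <- !Cpow_mult_r.
      replace ((- q) ^ j) with ((- (1)) ^ j * q ^ j)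
        by (rewrite <- Cpow_mult_l; f_equal; ring).
      rewrite (Cpow_add_r (- (1))).
      assert (He : q ^ (2 * tri (i + j)) * q ^ j
                   = q ^ tri i * q ^ (tri i + 2 * i * j + j * j)).
      { rewrite <- !Cpow_add_r. f_equal.
        pose proof (tri_double i). pose proof (tri_double j).
        pose proof (tri_double (i + j)). nia. }
      (* This groups the doubled sign [(-1)^j (-1)^j = 1] and the powers of [q] that [He]
         rewrites. *)
      transitivity ((- (1)) ^ i * ((- (1)) ^ j * (- (1)) ^ j) * u ^ (i + j)
        * (q ^ (2 * tri (i + j)) * q ^ j) * q ^ (2 * tri j)
        / (qpoch q q i * qpoch (q ^ 2) (q ^ 2) j)).
      * field. split; apply qpoch_neq_0; assumption.
      * rewrite Hsq, He. field. split; apply qpoch_neq_0; assumption.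
  (* The rate [(1/4)^2] in [j] becomes [(1/4)^m] in the padded index [m = 2j]. *)
  - destruct (summand_bound q (- u) (u ^ 2) ((/ 4) ^ 2) hq1) as [K [HK0 HK]];
      [apply pow_lt; lra|].
    apply is_double_series_even.
    apply is_double_series_antidiagonals with K; [exact HK0 | |].
    + intros i m. unfold even_ext. destruct (Nat.even m) eqn:Em.
      * apply Nat.even_spec in Em. destruct Em as [j ->]. rewrite Nat.div2_double.
        rewrite pow_add, pow_mult, <- Rmult_assoc.
        rewrite Cpow_add_r, Cpow_mult_r, Cmult_assoc, <- Hsgn. apply HK.
      * rewrite Cmod_0. apply Rmult_le_pos; [exact HK0 | apply pow_le; lra].
    + eapply is_series_ext; [|apply (euler_series _ u hq1)]. intros n. eq_in_C.
      transitivity ((- u) ^ n * q ^ tri n *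
        conv (euler_coef q) (even_ext (fun j => / qpoch (q ^ 2) (q ^ 2) j)) n).
      { rewrite conv_euler_inv_qpoch_even by exact hq1.
        unfold euler_coef. field. apply qpoch_neq_0, hq1. }
      unfold conv. rewrite <- sum_n_scal_C. apply sum_n_ext_loc. intros i Hi. eq_in_C.
      (* Only the [i] with [n - i = 2j] contribute; both sides vanish for the others. *)
      unfold even_ext. destruct (Nat.even (n - i)) eqn:Em; [|ring].
      apply Nat.even_spec in Em. destruct Em as [j Hj]. rewrite Hj, Nat.div2_double.
      replace n with (i + 2 * j)%nat by lia.
      rewrite summand_euler_coef by exact hq1.
      unfold euler_coef. rewrite Hsgn, <- !Cpow_mult_r.
      rewrite (Cpow_add_r (- (1))), Cpow_mult_r.
      replace ((- (1)) ^ 2) with (RtoC 1) by (simpl; ring). rewrite Cpow_1_l.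
      assert (He : q ^ tri (i + 2 * j) = q ^ (2 * tri j) * q ^ (tri i + 2 * i * j + j * j)).
      { rewrite <- !Cpow_add_r. f_equal.
        pose proof (tri_double i). pose proof (tri_double j).
        pose proof (tri_double (i + 2 * j)). nia. }
      rewrite He. field. split; apply qpoch_neq_0; assumption.
Qed.
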